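(* Let $p$ be a prime, let $k$ be a positive integer, and write $k=2^v w$ with $w$ odd. Let $n$ be a positive integer and put $d=\gcd(n,4k)$. Then $$-p^{-n/2}\left[\#H_k(\mathbb F_{p^n})-(p^n+1)\right]=\begin{cases} 0 & \text{if } 2^{v+1}\nmid d,\\ -p^{d/2}(p^{d/2}-1) & \text{if } 2^{v+1}\,\|\,d,\\ p^{d/4}(p^{d/4}-1) & \text{if } 2^{v+2}\mid d. \end{cases}$$
   Context: $H_k=H_k^{(p)}$ denotes the Hermitian curve $y^{p^k}+y=x^{p^k+1}$ over $\mathbb F_p$ (its smooth projective model, which has exactly one point at infinity), so $\#H_k(\mathbb F_{p^n})$ equals $1$ plus the number of pairs $(x,y)\in\mathbb F_{p^n}^2$ with $y^{p^k}+y=x^{p^k+1}$. The notation $2^{a}\,\|\,d$ means $2^a\mid d$ and $2^{a+1}\nmid d$. *)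

(* Defs.v *)
From mathcomp Require Import all_boot all_order all_algebra.

Set Implicit Arguments.
Unset Strict Implicit.
Unset Printing Implicit Defensive.

Import GRing.Theory.
Local Open Scope ring_scope.

(* Points of the projective plane over F are encoded as the lines through the *)
(* origin of F^3, each line being the finite set of its vectors.              *)
Definition proj_point (F : finFieldType) (u : 'rV[F]_3) : {set 'rV[F]_3} :=
  [set a *: u | a : F].

(* Homogenization of y^q + y = x^(q+1), with [x : y : z] the coordinates      *)
(* 0, 1, 2 of u. When q is a power of the characteristic, the partial         *)
(* derivatives of Y^q Z + Y Z^q - X^(q+1) are - X^q, Z^q and Y^q, so this     *)
(* plane projective curve is smooth: it is the smooth projective model of the *)
(* affine curve, and [0 : 1 : 0] is its only point with z = 0.                *)
Definition on_hermitian (F : finFieldType) (q : nat) (u : 'rV[F]_3) : bool :=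
  let x := u 0 0 in let y := u 0 1 in let z := u 0 2%:R in
  y ^+ q * z + y * z ^+ q == x ^+ q.+1.

(* The equation has coefficients in the prime field; the F-rational points    *)
(* of H_k^(p) are meant for F of characteristic p.                            *)
Definition hermitian_points (F : finFieldType) (p k : nat)
    : {set {set 'rV[F]_3}} :=
  [set proj_point u | u : 'rV[F]_3 & (u != 0) && on_hermitian (p ^ k) u].

(* 2^a || d *)
Definition exactly_pow2 (a d : nat) : bool :=
  (2 ^ a %| d)%N && ~~ (2 ^ a.+1 %| d)%N.

(* Main.v *)
Require Import Defs.
From mathcomp Require Import all_boot all_order all_algebra.
From mathcomp Require Import cyclic finfield.
From mathcomp Require Import zify ring.
From mathcomp Require Import reals exp.

Set Implicit Arguments.
Unset Strict Implicit.
Unset Printing Implicit Defensive.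

Import Order.TTheory GRing.Theory Num.Theory.
Local Open Scope ring_scope.

(** Put q = p^k, V = p^n = #|F|, g = gcd(k, n), Q = p^g.  The projective
    curve has one point more than the affine curve y^q + y = x^(q+1).  The
    additive map L(y) = y^q + y and the multiplicative map N(x) = x^(q+1)
    behave in two different ways, according to the 2-adic valuations of k
    and n.

    If 2^(v+1) does not divide n, then gcd(2k, n) = gcd(k, n), so every x
    with x^(q^2) = x already satisfies x^q = x.  For p odd this makes L
    injective, and for p = 2 it makes N injective; in both cases the affine
    curve is the graph of a function and has exactly V points
    ([card_affine_hermitian_odd]).

    Otherwise n = 2gm, k = gr with r coprime to 2m.  Then F contains the
    fields K of order Q and E of order Q^2, fixed respectively by x -> x^q
    and by its square, L and N restrict to the trace and the norm of E / K,
    and L : F -> F is K-linear with a kernel of order Q.  Let I be its image.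
    The affine curve has Q * Z points, where Z is the number of x with N(x)
    in I.  Three facts determine Z:
    - For t outside I the number M of x with N(x) in t + I does not depend on
      t, because F = K t + I and multiplication of x by a suitable
      element of E multiplies N(x) by any prescribed element of K.  Hence
      V = Z + (Q - 1) M.
    - Modulo I one has N(x + y) - N(x) = N(y) + x^q (y - y^(q^2)).  For
      fixed y outside E this is a bijective function of x, and for y in E
      it is always in I.  Counting the pairs whose norms are congruent
      modulo I gives the second moment
      Z^2 + (Q - 1) M^2 = Q^2 V + (V - Q^2) V / Q.
    - The nonzero elements of E act freely on the nonzero x with N(x) in I,
      so Z = 1 modulo Q^2 - 1.
    The first two facts yield (Z - M)^2 = (Q^(m+1))^2, and the third one
    selects the sign: Z - M = 1 modulo Q + 1, so
    Z - M = - (-1)^m Q^(m+1) ([moments_solution]).  The affine curve has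
    therefore V - (-1)^m (Q - 1) Q^(m+1) points, without any recourse to
    character sums.  The last two cases of the theorem are m odd (d = 2g)
    and m even (d = 4g). *)

(** * Fibres, roots of unity and fixed fields of Frobenius powers *)

Lemma card_uniform_fibres (T U : finType) (f : T -> U) (D : {set T}) (c : nat) :
  (forall x, x \in D -> #|[set y in D | f y == f x]| = c) ->
  #|D| = (#|f @: D| * c)%N.
Proof.
move=> fibre_card; rewrite -sum1_card (partition_big_imset f) /=.
rewrite -sum_nat_const; apply: eq_bigr => u /imsetP[x xD ->].
rewrite -(fibre_card x xD) -sum1_card; apply: eq_bigl => y.
by rewrite inE.
Qed.

Lemma card_unity_roots (F : finFieldType) (m : nat) (z : F) :
  m.-primitive_root z -> #|[set x : F | x ^+ m == 1]| = m.
Proof.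
move=> z_prim; rewrite -[RHS]card_ord -cardsT.
rewrite -(@card_in_imset _ _ (fun i : 'I_m => z ^+ i)).
  apply: eq_card => x; rewrite inE; apply/eqP/imsetP.
    by move=> /(prim_rootP z_prim)[i ->]; exists i.
  by move=> [i _ ->]; rewrite exprAC (prim_expr_order z_prim) expr1n.
move=> i j _ _ /eqP; rewrite (eq_prim_root_expr z_prim) !modn_small //.
by move=> /eqP/val_inj.
Qed.

Lemma expf_card_pred (F : finFieldType) (x : F) : x != 0 -> x ^+ #|F|.-1 = 1.
Proof.
move=> x_neq0; apply: (mulfI x_neq0); rewrite mulr1 -exprS prednK ?expf_card //.
exact: ltnW (finNzRing_gt1 F).
Qed.

Lemma prim_root_dvd_card (F : finFieldType) (m : nat) :
  (m %| #|F|.-1)%N -> exists z : F, m.-primitive_root z.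
Proof.
move=> m_dvd; have F_gt1 := finNzRing_gt1 F.
have: has (#|F|.-1).-primitive_root [seq x <- enum F | x != 0].
  apply: has_prim_root; first by rewrite -subn1 subn_gt0.
  - apply/allP => x; rewrite mem_filter unity_rootE => /andP[x_neq0 _].
    by rewrite (expf_card_pred x_neq0).
  - by rewrite filter_uniq ?enum_uniq.
  - rewrite -(cardC1 (0 : F)) cardE; apply: uniq_leq_size (enum_uniq _) _ => x.
    by rewrite mem_enum inE mem_filter mem_enum => ->.
case/hasP=> z _ z_prim; exists (z ^+ (#|F|.-1 %/ m)).
exact: (dvdn_prim_root z_prim m_dvd).
Qed.

Section FrobeniusFixedField.

Variables (p n : nat) (F : finFieldType).
Hypotheses (p_prime : prime p) (cardF : #|F| = (p ^ n)%N).

Lemma card_exponent_gt0 : (0 < n)%N.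
Proof. by case: n cardF (finNzRing_gt1 F) => // ->. Qed.

Lemma exprD_pow (j : nat) (x y : F) :
  (x + y) ^+ (p ^ j) = x ^+ (p ^ j) + y ^+ (p ^ j).
Proof.
apply: exprDn_pchar; rewrite pnatX; apply/orP; left.
by rewrite pnatE // (card_finPcharP cardF p_prime).
Qed.

Lemma frobenius_iter_fixed (j s : nat) (x : F) :
  x ^+ (p ^ j) = x -> x ^+ (p ^ (j * s)) = x.
Proof.
move=> x_fix; elim: s => [|s IHs]; first by rewrite muln0 expr1.
by rewrite mulnS expnD exprM x_fix.
Qed.

(** The exponents j for which x -> x^(p^j) fixes x are stable under Bezout
    combinations, and n is one of them. *)
Lemma frobenius_fixed_gcd (j : nat) (x : F) :
  (x ^+ (p ^ j) == x) = (x ^+ (p ^ gcdn j n) == x).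
Proof.
have x_fixn : x ^+ (p ^ n) = x by rewrite -cardF expf_card.
apply/eqP/eqP=> [x_fixj|x_fixg]; last first.
  by rewrite -(divnK (dvdn_gcdl j n)) mulnC; apply: frobenius_iter_fixed.
have [u v uv _] := egcdnP j card_exponent_gt0.
rewrite -[RHS](frobenius_iter_fixed u x_fixn) mulnC uv expnD exprM.
by rewrite mulnC frobenius_iter_fixed // gcdnC.
Qed.

(** The fixed points of x -> x^(p^j) are those of x -> x^(p^g) for the divisor
    g = gcd(j, n) of n, that is 0 and the roots of unity of order dividing
    p^g - 1; this order divides #|F| - 1, so all of them are in F. *)
Lemma card_frobenius_fixed (j : nat) :
  #|[set x : F | x ^+ (p ^ j) == x]| = (p ^ gcdn j n)%N.
Proof.
set g := gcdn j n; have g_gt0 : (0 < g)%N.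
  by rewrite gcdn_gt0 card_exponent_gt0 orbT.
have pg_gt1 : (1 < p ^ g)%N by rewrite -(exp1n g) ltn_exp2r ?prime_gt1.
have [z z_prim] : exists z : F, (p ^ g).-1.-primitive_root z.
  apply: prim_root_dvd_card.
  by rewrite cardF -(divnK (dvdn_gcdr j n)) mulnC expnM dvdn_pred_predX.
have -> : [set x : F | x ^+ (p ^ j) == x] = 0 |: [set x | x ^+ (p ^ g).-1 == 1].
  apply/setP=> x; rewrite !inE frobenius_fixed_gcd -/g.
  rewrite -(ltn_predK pg_gt1) exprS.
  have [->|x_neq0] := eqVneq x 0; first by rewrite mul0r eqxx.
  by rewrite -[X in _ == X]mulr1 (inj_eq (mulfI x_neq0)).
have m_gt0 : (0 < (p ^ g).-1)%N by rewrite -subn1 subn_gt0.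
rewrite cardsU1 (card_unity_roots z_prim) inE expr0n gtn_eqF //.
by rewrite (eq_sym 0) oner_eq0 add1n (ltn_predK pg_gt1).
Qed.

End FrobeniusFixedField.

(** * Solving the moment equations *)

Lemma expr_mod_succ (R : comPzRingType) (a : R) (j : nat) :
  exists r : R, a ^+ j = (-1) ^+ j + r * (a + 1).
Proof.
elim: j => [|j [r IHj]]; first by exists 0; rewrite !expr0 mul0r addr0.
by exists (a * r + (-1) ^+ j); rewrite !exprS IHj; ring.
Qed.

Lemma succ_ndvd_two (a k : int) : 1 < a -> (a + 1) * k <> -2.
Proof.
move=> a_gt1; have [k_ge0|k_lt0] := lerP 0 k.
  by have : 0 <= (a + 1) * k by [apply: mulr_ge0; lia]; lia.
have : (a + 1) * (k + 1) <= 0 by apply: mulr_ge0_le0; lia.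
by rewrite mulrDr mulr1; lia.
Qed.

(** With S = Z - M, the two moments give S^2 = (Q^(m+1))^2.  Since Z = 1 and
    Q^(2m) = 1 modulo Q^2 - 1, S = 1 modulo Q + 1, whereas
    Q^(m+1) = (-1)^(m+1) modulo Q + 1.  As Q + 1 > 2, only one of the two
    signs is possible.  The number i stands for the order of the image of the
    trace map, which is Q^(2m) / Q. *)
Lemma moments_solution (Q m Z M i : nat) :
  (1 < Q)%N -> (0 < m)%N -> (0 < Z)%N ->
  (Q ^ (2 * m) = i * Q)%N ->
  (Q ^ (2 * m) = Z + (Q - 1) * M)%N ->
  (Z * Z + (Q - 1) * M * M
     = Q ^ 2 * Q ^ (2 * m) + (Q ^ (2 * m) - Q ^ 2) * i)%N ->
  (Q ^ 2 - 1 %| Z - 1)%N ->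
  (Z * Q)%:Z = Q%:Z ^+ (2 * m) - (-1) ^+ m * (Q%:Z - 1) * Q%:Z ^+ m.+1.
Proof.
move=> Q_gt1 m_gt0 Z_gt0 hV h1 h2 /dvdnP[z hZ].
have /dvdnP[w hW] : ((Q ^ 2).-1 %| (Q ^ (2 * m)).-1)%N.
  by rewrite expnM dvdn_pred_predX.
have V_ge : (Q ^ 2 <= Q ^ (2 * m))%N.
  by rewrite leq_exp2l // -[X in (X <= _)%N]muln1 leq_mul2l.
have Q2_gt0 : (0 < Q ^ 2)%N by rewrite expn_gt0 ltnW.
have aX j : Q%:Z ^+ j = (Q ^ j)%N%:Z by rewrite -[Q%:Z]natz -natrX natz.
have {}hV : Q%:Z ^+ (2 * m) = i%:Z * Q%:Z by rewrite -PoszM -hV aX.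
have {}h1 : Q%:Z ^+ (2 * m) = Z%:Z + (Q%:Z - 1) * M%:Z.
  by rewrite aX subzn ?(ltnW Q_gt1) // -PoszM -PoszD h1.
have {}h2 : Z%:Z * Z%:Z + (Q%:Z - 1) * M%:Z * M%:Z
    = Q%:Z ^+ 2 * Q%:Z ^+ (2 * m) + (Q%:Z ^+ (2 * m) - Q%:Z ^+ 2) * i%:Z.
  by rewrite !aX !subzn ?(ltnW Q_gt1) // -!PoszM -!PoszD h2.
have {}hZ : Z%:Z - 1 = z%:Z * (Q%:Z ^+ 2 - 1).
  by rewrite aX; lia.
have {}hW : Q%:Z ^+ (2 * m) - 1 = w%:Z * (Q%:Z ^+ 2 - 1).
  by rewrite !aX; lia.
have {Q2_gt0 V_ge} a_gt1 : 1 < Q%:Z by [].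
rewrite PoszM; set a := Q%:Z in hV h1 h2 hZ hW a_gt1 *.
set V := a ^+ (2 * m) in hV h1 h2 hW *.
move: Z%:Z M%:Z i%:Z z%:Z w%:Z hV h1 h2 hZ hW.
move=> {Z Z_gt0} Z {M} M {i} i {z} z {w} w hV h1 h2 hZ hW.
have sub_a_neq0 : a - 1 != 0 by lia.
(* The second moment times a, minus the square of the first moment. *)
have S_sqr : (Z - M) ^+ 2 = (a ^+ m.+1) ^+ 2.
  apply: (mulfI sub_a_neq0); have -> : (a ^+ m.+1) ^+ 2 = a ^+ 2 * V.
    by rewrite -exprM -exprD; congr (_ ^+ _); lia.
  have -> : (a - 1) * (Z - M) ^+ 2
     = a * (Z * Z + (a - 1) * M * M) - (Z + (a - 1) * M) ^+ 2 by ring.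
  rewrite h2 -h1 mulrDr [a * ((V - _) * i)]mulrCA [a * i]mulrC -hV; ring.
have aZ : Z * a = V + (a - 1) * (Z - M) by rewrite h1; ring.
have S_mod : Z - M - 1 = (a + 1) * (a * z - w).
  apply: (mulfI sub_a_neq0).
  have -> : (a - 1) * (Z - M - 1) = a * (Z - 1) - (V - 1) by rewrite h1; ring.
  by rewrite hZ hW; ring.
have [r rE] := expr_mod_succ a m.+1.
suff -> : Z * a = V + (a - 1) * ((-1) ^+ m.+1 * a ^+ m.+1).
  by rewrite exprS; ring.
rewrite aZ; congr (_ + _ * _).
have sign_m : (-1) ^+ m.+1 = 1 :> int \/ (-1) ^+ m.+1 = -1 :> int.
  by rewrite -signr_odd; case: (odd m.+1); [right | left].
move/eqP: S_sqr; rewrite eqf_sqr rE => /orP[] /eqP SE; rewrite SE in S_mod *;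
  case: sign_m => sign_m; rewrite sign_m in S_mod *.
- by rewrite mul1r.
- case: (succ_ndvd_two a_gt1 (k := a * z - w - r)).
  by rewrite mulrBr -S_mod; ring.
- case: (succ_ndvd_two a_gt1 (k := a * z - w + r)).
  by rewrite mulrDr -S_mod; ring.
- by rewrite mulN1r.
Qed.

(** * The affine curve over a tower K < E < F *)

Definition affine_hermitian (F : finFieldType) (q : nat) : {set F * F} :=
  [set xy | xy.2 ^+ q + xy.2 == xy.1 ^+ q.+1].

Section HermitianCount.

(** Here K and E are the fixed points of x -> x^q and of its square.  The
    exponent q may be much larger than Q: the two powers agree on E, but in
    general not on F. *)

Variables (F : finFieldType) (q Q : nat).
Hypotheses (Q_gt1 : (1 < Q)%N)
  (frobD : forall x y : F, (x + y) ^+ q = x ^+ q + y ^+ q)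
  (card_fixed : #|[set x : F | x ^+ q == x]| = Q)
  (card_fixed2 : #|[set x : F | x ^+ q ^+ q == x]| = (Q ^ 2)%N)
  (norm_surj : forall b : F, b ^+ q = b ->
     exists2 a : F, a ^+ q ^+ q = a & a ^+ q.+1 = b).

(** On E this is the trace to K; on F it is only a K-linear map. *)
Let trace (y : F) := y ^+ q + y.
Let I : {set F} := trace @: setT.

Lemma frob0 : (0 : F) ^+ q = 0.
Proof. by apply: (addIr (0 ^+ q)); rewrite -frobD !add0r. Qed.

Lemma frobN (x : F) : (- x) ^+ q = - x ^+ q.
Proof. by apply: (addIr (x ^+ q)); rewrite -frobD !addNr frob0. Qed.

Lemma frob_inj : injective (fun x : F => x ^+ q).
Proof.
move=> x y /= /eqP; rewrite -subr_eq0 -frobN -frobD expf_eq0 subr_eq0.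
by case/andP=> _ /eqP.
Qed.

Lemma traceD (x y : F) : trace (x + y) = trace x + trace y.
Proof. by rewrite /trace frobD addrACA. Qed.

Lemma traceN (x : F) : trace (- x) = - trace x.
Proof. by rewrite /trace frobN opprD. Qed.

Lemma trace_imgP (u : F) : reflect (exists y, u = trace y) (u \in I).
Proof.
by apply: (iffP imsetP) => [[y _ ->]|[y ->]]; exists y.
Qed.

Lemma trace_imgD (u v : F) : u \in I -> v \in I -> u + v \in I.
Proof.
move=> /trace_imgP[x ->] /trace_imgP[y ->]; apply/trace_imgP; exists (x + y).
by rewrite traceD.
Qed.

Lemma trace_imgN (u : F) : u \in I -> - u \in I.
Proof.
by move=> /trace_imgP[x ->]; apply/trace_imgP; exists (- x); rewrite traceN.
Qed.

Lemma trace_imgDr (u v : F) : v \in I -> (u + v \in I) = (u \in I).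
Proof.
move=> vI; apply/idP/idP=> [uvI|uI]; last exact: trace_imgD.
by rewrite -(addrK v u); apply: trace_imgD uvI (trace_imgN vI).
Qed.

Lemma trace_imgZ (b u : F) : b ^+ q = b -> u \in I -> b * u \in I.
Proof.
move=> b_fix /trace_imgP[x ->]; apply/trace_imgP; exists (b * x).
by rewrite /trace exprMn b_fix mulrDr.
Qed.

(** For a in E but not in K, c = a - a^q satisfies c^q = - c, and the kernel
    is the line K c. *)
Lemma card_trace_ker : #|[set y : F | trace y == 0]| = Q.
Proof.
have /subsetPn[a] :
  ~~ ([set x : F | x ^+ q ^+ q == x] \subset [set x | x ^+ q == x]).
  apply/negP => /subset_leq_card; rewrite card_fixed card_fixed2.
  by rewrite leqNgt -[X in (X < _)%N]expn1 ltn_exp2l.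
rewrite !inE => /eqP a_fix2 a_nfix.
pose c := a - a ^+ q; have c_neq0 : c != 0 by rewrite subr_eq0 eq_sym.
have cq : c ^+ q = - c by rewrite frobD frobN a_fix2 opprB.
rewrite -card_fixed -[RHS](card_imset _ (mulIf c_neq0)); apply: eq_card => y.
rewrite inE; apply/eqP/imsetP=> [y_ker|[b]].
  exists (y / c); last by rewrite divfK.
  rewrite inE exprMn exprVn cq invrN mulrN -mulNr.
  by rewrite (inj_eq (mulIf _)) ?invr_eq0 // eqr_oppLR -addr_eq0; apply/eqP.
by rewrite inE => /eqP b_fix ->; rewrite /trace exprMn b_fix cq mulrN addNr.
Qed.

Lemma card_trace_fibre (x : F) : #|[set y : F | trace y == trace x]| = Q.
Proof.
rewrite -card_trace_ker -[RHS](card_imset _ (addIr x)); apply: eq_card => y.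
rewrite inE; apply/eqP/imsetP=> [yx|[z]].
  exists (y - x); last by rewrite subrK.
  by rewrite inE traceD traceN yx subrr.
by rewrite inE => /eqP z_ker ->; rewrite traceD z_ker add0r.
Qed.

Lemma card_trace_img : #|F| = (#|I| * Q)%N.
Proof.
rewrite -cardsT; apply: card_uniform_fibres => x _.
by rewrite -(card_trace_fibre x); apply: eq_card => y; rewrite !inE.
Qed.

(** The trace cannot vanish on E, whose order exceeds that of the kernel; so
    it has a nonzero value s in K, and by K-linearity every b = (b / s) s is a
    value. *)
Lemma fixed_trace_img (b : F) : b ^+ q = b -> b \in I.
Proof.
move=> b_fix.
have /subsetPn[z] :
  ~~ ([set x : F | x ^+ q ^+ q == x] \subset [set x | trace x == 0]).
  apply/negP => /subset_leq_card; rewrite card_trace_ker card_fixed2.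
  by rewrite leqNgt -[X in (X < _)%N]expn1 ltn_exp2l.
rewrite !inE => /eqP z_fix2 s_neq0.
have s_fix : trace z ^+ q = trace z by rewrite frobD z_fix2 addrC.
rewrite -(divfK s_neq0 b) trace_imgZ ?exprMn ?exprVn ?b_fix ?s_fix //.
by apply/trace_imgP; exists z.
Qed.

Lemma norm_fixed (a : F) : a ^+ q ^+ q = a -> (a ^+ q.+1) ^+ q = a ^+ q.+1.
Proof. by move=> a_fix2; rewrite exprS exprMn a_fix2 mulrC. Qed.

Let coset_count (t : F) := #|[set x : F | x ^+ q.+1 - t \in I]|.

Lemma coset_count_shift (t u : F) :
  u - t \in I -> coset_count u = coset_count t.
Proof.
move=> utI; apply: eq_card => x; rewrite !inE.
rewrite -[RHS](trace_imgDr _ (trace_imgN utI)).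
by congr (_ \in I); ring.
Qed.

Lemma coset_count_scale (a t : F) : a != 0 -> a ^+ q ^+ q = a ->
  coset_count (a ^+ q.+1 * t) = coset_count t.
Proof.
move=> a_neq0 a_fix2; have Na_fix := norm_fixed a_fix2.
rewrite /coset_count -[RHS](card_imset _ (mulfI a_neq0)); apply: eq_card => x.
rewrite inE; apply/idP/imsetP => [xI|[y]].
  exists (a^-1 * x); last by rewrite mulVKf.
  rewrite inE exprMn exprVn -[t](mulKf (expf_neq0 q.+1 a_neq0)) -mulrBr.
  by apply: trace_imgZ xI; rewrite exprVn Na_fix.
by rewrite inE => yI ->; rewrite exprMn -mulrBr; apply: trace_imgZ.
Qed.

(** The sum K t + I is direct because I is a K-subspace not containing t; it
    has order Q * #|I| = #|F|, so it is everything. *)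
Lemma trace_img_complement (t u : F) : t \notin I ->
  exists2 b : F, b ^+ q = b & u - b * t \in I.
Proof.
move=> tNI; pose K := [set x : F | x ^+ q == x].
have dec_inj : {in setX K I &, injective (fun bz : F * F => bz.1 * t + bz.2)}.
  move=> [b z] [b' z'] /setXP[/= bK zI] /setXP[/= b'K z'I] /= eq_bz.
  have [eq_b|neq_b] := eqVneq b b'.
    by move: eq_bz; rewrite eq_b => /addrI ->.
  case/negP: tNI; have bb_neq0 : b - b' != 0 by rewrite subr_eq0.
  rewrite -(mulKf bb_neq0 t); apply: trace_imgZ.
    rewrite exprVn frobD frobN.
    by move: bK b'K; rewrite !inE => /eqP -> /eqP ->.
  have -> : (b - b') * t = z' - z.
    by apply/eqP; rewrite mulrBl subr_eq addrAC eq_sym subr_eq addrC -eq_bz.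
  exact: trace_imgD z'I (trace_imgN zI).
have dec_full : [set bz.1 * t + bz.2 | bz in setX K I] = setT.
  apply/eqP; rewrite eqEcard subsetT (card_in_imset dec_inj) cardsX card_fixed.
  by rewrite cardsT card_trace_img mulnC leqnn.
have : u \in [set: F] by rewrite inE.
rewrite -dec_full => /imsetP[[b z] /setXP[/= bK zI] ->].
by exists b; [apply/eqP; move: bK; rewrite inE | rewrite addrC addKr].
Qed.

(** Modulo I any two elements outside I differ by a factor b in K; b is the
    norm of some a in E, and x -> a x matches the two counts. *)
Lemma coset_count_const (t u : F) :
  t \notin I -> u \notin I -> coset_count u = coset_count t.
Proof.
move=> tNI uNI; have [b b_fix ubtI] := trace_img_complement u tNI.
have [a a_fix2 ab] := norm_surj b_fix.
rewrite (coset_count_shift ubtI) -ab coset_count_scale //.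
apply: contraNneq uNI => a0; move: ubtI.
by rewrite -ab a0 expr0n mul0r subr0.
Qed.

Lemma coset_count_img (t : F) : t \in I -> coset_count t = coset_count 0.
Proof. by move=> tI; apply: coset_count_shift; rewrite subr0. Qed.

(** Each x is counted once for every t in x^(q+1) + I. *)
Lemma sum_coset_count : (\sum_t coset_count t = #|F| * #|I|)%N.
Proof.
under eq_bigr do rewrite /coset_count -sum1_card big_mkcond /=.
rewrite exchange_big /= -sum_nat_const. apply: eq_big => // x _.
have sub_inj : injective (fun t : F => x ^+ q.+1 - t).
  by move=> t u /addrI/oppr_inj.
rewrite -(on_card_preimset (onW_bij _ (injF_bij sub_inj))) -sum1_card.
by rewrite -big_mkcond; apply: eq_bigl => t; rewrite !inE.
Qed.

(** The two sides differ by trace (x * y^q): the cross term x y^q is congruent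
    to - x^q y^(q^2) modulo I. *)
Lemma norm_increment (x y : F) :
  ((x + y) ^+ q.+1 - x ^+ q.+1 \in I)
    = (y ^+ q.+1 + x ^+ q * (y - y ^+ q ^+ q) \in I).
Proof.
have xyI : trace (x * y ^+ q) \in I by apply/trace_imgP; exists (x * y ^+ q).
rewrite -[RHS](trace_imgDr _ xyI); congr (_ \in I).
by rewrite /trace !exprS exprMn frobD; ring.
Qed.

(** If y is in E, the increment is the norm of y, which is in K and hence in
    I; otherwise it is a bijective affine function of x^q. *)
Lemma card_norm_increment (y : F) :
  #|[set x : F | (x + y) ^+ q.+1 - x ^+ q.+1 \in I]|
    = if y ^+ q ^+ q == y then #|F| else #|I|.
Proof.
case: eqVneq => [y_fix2|y_nfix2].
  rewrite -cardsT; apply: eq_card => x; rewrite !inE norm_increment y_fix2.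
  by rewrite subrr mulr0 addr0 fixed_trace_img // norm_fixed.
have yy_neq0 : y - y ^+ q ^+ q != 0 by rewrite subr_eq0 eq_sym.
have aff_inj : injective (fun x : F => y ^+ q.+1 + x ^+ q * (y - y ^+ q ^+ q)).
  by move=> x x' /addrI/(mulIf yy_neq0)/frob_inj.
rewrite -[RHS](on_card_preimset (onW_bij _ (injF_bij aff_inj))).
by apply: eq_card => x; rewrite !inE norm_increment.
Qed.

(** The left-hand side counts the pairs of elements with norms congruent
    modulo I; the pairs are enumerated as (x, x + y) with y fixed. *)
Lemma sum_coset_count_norm :
  (\sum_(x : F) coset_count (x ^+ q.+1)
    = Q ^ 2 * #|F| + (#|F| - Q ^ 2) * #|I|)%N.
Proof.
transitivity (\sum_(y : F)
  #|[set x : F | ((x + y) ^+ q.+1 - x ^+ q.+1)%R \in I]|)%N.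
  under [RHS]eq_bigr do rewrite -sum1_card big_mkcond /=.
  rewrite [RHS]exchange_big /=; apply: eq_bigr => x _.
  rewrite -big_mkcond /= /coset_count -sum1_card (reindex_inj (addrI x)).
  by apply: eq_bigl => y; rewrite !inE.
under eq_bigr do rewrite card_norm_increment.
pose E := [set y : F | y ^+ q ^+ q == y].
have cardE : #|E| = (Q ^ 2)%N := card_fixed2.
have -> : (#|F| - Q ^ 2 = #|~: E|)%N by rewrite -(cardsC E) cardE addKn.
rewrite (bigID (mem E)) /= -cardE -!sum_nat_const.
congr addn; apply: eq_big => y; rewrite !inE //; first by move=> ->.
by move=> /negPf ->.
Qed.

Lemma trace_img_proper : exists t : F, t \notin I.
Proof.
have /subsetPn[t _ tNI] : ~~ ([set: F] \subset I); last by exists t.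
apply/negP => /subset_leq_card; rewrite cardsT card_trace_img.
have I_gt0 : (0 < #|I|)%N.
  by apply/card_gt0P; exists (trace 0); apply: imset_f; rewrite inE.
by nia.
Qed.

Lemma sum_coset_count_comp (f : F -> F) (t : F) : t \notin I ->
  (\sum_x coset_count (f x)
    = #|f @^-1: I| * coset_count 0%R + (#|F| - #|f @^-1: I|) * coset_count t)%N.
Proof.
move=> tNI; rewrite -(cardsC (f @^-1: I)) addKn -!sum_nat_const.
rewrite (bigID (mem (f @^-1: I))) /=.
congr addn; apply: eq_big => x; rewrite !inE // => fxI.
  exact: coset_count_img.
exact: coset_count_const.
Qed.

Lemma two_moments (t : F) : t \notin I ->
     (#|F| = coset_count 0%R + (Q - 1) * coset_count t)%N
  /\ (coset_count 0%R * coset_count 0%R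
         + (Q - 1) * coset_count t * coset_count t
       = Q ^ 2 * #|F| + (#|F| - Q ^ 2) * #|I|)%N.
Proof.
move=> tNI.
have FE : (#|F| = coset_count 0%R + (Q - 1) * coset_count t)%N.
  have := sum_coset_count_comp id tNI; rewrite sum_coset_count card_trace_img.
  have -> : id @^-1: I = I by apply/setP=> x; rewrite inE.
  have I_gt0 : (0 < #|I|)%N.
    by apply/card_gt0P; exists (trace 0); apply: imset_f; rewrite inE.
  by nia.
split=> //; rewrite -sum_coset_count_norm (sum_coset_count_comp _ tNI).
have -> : #|(fun x : F => x ^+ q.+1) @^-1: I| = coset_count 0.
  by apply: eq_card => x; rewrite !inE subr0.
by rewrite FE addKn.
Qed.

(** Nonzero elements x, y with x^(q^2) / x = y^(q^2) / y differ by a factor in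
    E, so the fibres of this quotient are the orbits of the nonzero elements
    of E, which all have Q^2 - 1 elements. *)
Lemma coset_count_0_mod : (Q ^ 2 - 1 %| coset_count 0%R - 1)%N.
Proof.
pose X := [set x : F | (x != 0) && (x ^+ q.+1 \in I)].
have I0 : 0 \in I by rewrite fixed_trace_img ?frob0.
have -> : (coset_count 0%R - 1 = #|X|)%N.
  rewrite /coset_count (cardsD1 0) inE expr0n subrr I0 add1n subn1 /=.
  by apply: eq_card => x; rewrite !inE subr0.
rewrite (@card_uniform_fibres _ _ (fun x => x ^+ q ^+ q / x) X (Q ^ 2 - 1)).
  exact: dvdn_mull.
move=> x; rewrite inE => /andP[x_neq0 xI].
have -> : (Q ^ 2 - 1 = #|[set a : F | (a != 0%R) && (a ^+ q ^+ q == a)%R]|)%N.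
  rewrite -card_fixed2 (cardsD1 0) inE !frob0 eqxx add1n subn1 /=.
  by apply: eq_card => a; rewrite !inE.
rewrite -[RHS](card_imset _ (mulIf x_neq0)); apply: eq_card => y.
rewrite !inE; apply/idP/imsetP=> [/andP[/andP[y_neq0 yI] /eqP yx]|[a]].
  exists (y / x); last by rewrite divfK.
  rewrite inE mulf_neq0 ?invr_eq0 //= !exprMn !exprVn.
  rewrite -(divfK y_neq0 (y ^+ q ^+ q)) yx.
  by apply/eqP; field; rewrite x_neq0 !expf_neq0.
rewrite inE => /andP[a_neq0 /eqP a_fix2] ->.
rewrite mulf_neq0 //= !exprMn a_fix2 trace_imgZ ?norm_fixed //=.
by rewrite -mulf_div divff ?mul1r.
Qed.

Lemma card_affine_hermitian_fibred :
  #|affine_hermitian F q| = (coset_count 0%R * Q)%N.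
Proof.
rewrite (@card_uniform_fibres _ _ fst _ Q) => [|[x y]].
  congr (_ * _)%N; apply: eq_card => x; rewrite inE subr0.
  apply/imsetP/trace_imgP=> [[[x' y]]|[y xy]].
    by rewrite inE /= => /eqP xy ->; exists y.
  by exists (x, y); rewrite // inE /= xy.
rewrite inE /= => /eqP xy.
have pair_inj : injective (pair x : F -> F * F) by move=> u v [].
rewrite -(card_trace_fibre y) -[RHS](card_imset _ pair_inj).
apply: eq_card => -[x' y']; rewrite !inE /=.
apply/andP/imsetP=> [[/eqP xy' /eqP eq_x]|[y'' yy'' [-> ->]]].
  by exists y'; rewrite ?eq_x // inE /trace xy' eq_x xy.
by move: yy''; rewrite inE /trace xy.
Qed.

Lemma card_affine_hermitian_tower (m : nat) : #|F| = (Q ^ (2 * m))%N ->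
  #|affine_hermitian F q|%:Z
    = Q%:Z ^+ (2 * m) - (-1) ^+ m * (Q%:Z - 1) * Q%:Z ^+ m.+1.
Proof.
move=> cardF; rewrite card_affine_hermitian_fibred.
have m_gt0 : (0 < m)%N.
  by rewrite lt0n; apply/eqP => m0; have := finNzRing_gt1 F; rewrite cardF m0.
have [t tNI] := trace_img_proper; have [FE FE2] := two_moments tNI.
apply: (@moments_solution Q m (coset_count 0) (coset_count t) #|I|);
  rewrite -?cardF //.
- apply/card_gt0P; exists 0.
  by rewrite inE subr0 expr0n fixed_trace_img ?frob0.
- exact: card_trace_img.
- exact: coset_count_0_mod.
Qed.

End HermitianCount.

(** * The points of the projective curve *)

Section ProjectiveClosure.

Variable F : finFieldType.

Definition hcoords (x y z : F) : 'rV[F]_3 := \row_j [:: x; y; z]`_j.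

Lemma hcoordsE (x y z : F) :
  (hcoords x y z 0 0 = x) * (hcoords x y z 0 1 = y)
  * (hcoords x y z 0 2%:R = z).
Proof. by rewrite !mxE. Qed.

Lemma hcoords_eta (u : 'rV[F]_3) : u = hcoords (u 0 0) (u 0 1) (u 0 2%:R).
Proof.
apply/rowP=> -[[|[|[|//]]] j_lt]; rewrite mxE /=; congr (u 0 _); exact: val_inj.
Qed.

Lemma hcoordsZ (a x y z : F) :
  a *: hcoords x y z = hcoords (a * x) (a * y) (a * z).
Proof. by rewrite [LHS]hcoords_eta; congr hcoords; rewrite mxE hcoordsE. Qed.

Lemma proj_pointZ (a : F) (u : 'rV[F]_3) :
  a != 0 -> proj_point (a *: u) = proj_point u.
Proof.
move=> a_neq0; apply/setP=> w; apply/imsetP/imsetP=> -[b _ ->].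
  by exists (b * a); rewrite ?scalerA.
by exists (b / a); rewrite ?scalerA ?divfK.
Qed.

Lemma proj_point_inj (u w : 'rV[F]_3) :
  proj_point u = proj_point w -> exists a : F, u = a *: w.
Proof.
move=> uw; have : u \in proj_point u.
  by apply/imsetP; exists 1; rewrite ?scale1r.
by rewrite uw => /imsetP[a _ ->]; exists a.
Qed.

(** A point with z = 0 has x = 0, so it is [0 : 1 : 0]; the other points are
    normalized by z = 1. *)
Lemma card_hermitian_points (p k : nat) : (0 < p)%N ->
  #|hermitian_points F p k| = #|affine_hermitian F (p ^ k)|.+1.
Proof.
move=> p_gt0; have q_gt0 : (0 < p ^ k)%N by rewrite expn_gt0 p_gt0.
set q := (p ^ k)%N in q_gt0 *.
pose chart (xy : F * F) := proj_point (hcoords xy.1 xy.2 1).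
pose infty := proj_point (hcoords 0 1 0).
have chart_inj : injective chart.
  move=> [x y] [x' y'] /proj_point_inj[a]; rewrite hcoordsZ /= => eq_h.
  have := congr1 (fun u : 'rV[F]_3 => u 0 2%:R) eq_h.
  rewrite /= !hcoordsE mulr1 => a1; move: eq_h; rewrite -a1 !mul1r => eq_h.
  have := congr1 (fun u : 'rV[F]_3 => u 0 0) eq_h.
  have := congr1 (fun u : 'rV[F]_3 => u 0 1) eq_h.
  by rewrite /= !hcoordsE => -> ->.
have -> : hermitian_points F p k = infty |: chart @: affine_hermitian F q.
  apply/setP=> l; rewrite !inE; apply/imsetP/orP=> [[u]|].
    rewrite inE (hcoords_eta u) /on_hermitian !hcoordsE -/q.
    move: (u 0 0) (u 0 1) (u 0 2%:R) => x y z /andP[u_neq0 uH ->].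
    have [z0|z_neq0] := eqVneq z 0.
      left; move: u_neq0 uH.
      rewrite z0 mulr0 [0 ^+ q]expr0n gtn_eqF // mulr0 addr0.
      rewrite [0 == _]eq_sym expf_eq0 /= => u_neq0 /eqP x0; apply/eqP.
      have -> : hcoords x y 0 = y *: hcoords 0 1 0.
        by rewrite hcoordsZ !mulr0 mulr1 x0.
      rewrite proj_pointZ //; apply: contraNneq u_neq0 => ->.
      by apply/eqP/rowP=> -[[|[|[|//]]] j_lt]; rewrite !mxE ?x0.
    right; apply/imsetP; exists (x / z, y / z); last first.
      rewrite /chart /= -[RHS](proj_pointZ _ z_neq0) hcoordsZ mulr1.
      by rewrite ![z * (_ / z)]mulrC !divfK.
    rewrite inE /= !exprMn !exprVn.
    rewrite -(inj_eq (mulIf (expf_neq0 q.+1 z_neq0))) divfK ?expf_neq0 //.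
    rewrite mulrDl -(eqP uH); apply/eqP; congr (_ + _).
      by rewrite exprSr mulrA divfK ?expf_neq0.
    by rewrite exprS mulrA divfK.
  case=> [/eqP->|/imsetP[[x y]]].
    exists (hcoords 0 1 0) => //; rewrite inE /on_hermitian !hcoordsE.
    rewrite mulr0 expr0n gtn_eqF // mulr0 addr0 expr0n eqxx andbT.
    apply/eqP => /(congr1 (fun u : 'rV[F]_3 => u 0 1)) /eqP.
    by rewrite /= hcoordsE mxE oner_eq0.
  rewrite inE /= => xy ->; exists (hcoords x y 1) => //.
  rewrite inE /on_hermitian !hcoordsE expr1n !mulr1 xy andbT.
  apply/eqP => /(congr1 (fun u : 'rV[F]_3 => u 0 2%:R)) /eqP.
  by rewrite /= hcoordsE mxE oner_eq0.
rewrite cardsU1 (card_imset _ chart_inj) (_ : infty \notin _) //.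
apply/imsetP => -[[x y] _ /esym /proj_point_inj[a]].
move/(congr1 (fun u : 'rV[F]_3 => u 0 2%:R)) => /eqP.
by rewrite /= hcoordsZ !hcoordsE mulr0 oner_eq0.
Qed.

End ProjectiveClosure.

(** * Affine counts over the field of order p^n *)

Section AffineCounts.

Variables (p n : nat) (F : finFieldType).
Hypotheses (p_prime : prime p) (cardF : #|F| = (p ^ n)%N).

(** The fixed fields of x -> x^(p^k) and of its square have orders p^g and
    p^(2g) because gcd(k, n) = g and gcd(2k, n) = 2g.  Since r is odd,
    x -> x^(p^k) agrees with x -> x^(p^g) on the larger one, which gives the
    surjectivity of the norm. *)
Lemma card_affine_hermitian_even (g r m k : nat) :
  k = (g * r)%N -> n = (2 * g * m)%N -> coprime r (2 * m) ->
  #|affine_hermitian F (p ^ k)|%:Z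
    = (p ^ n)%:Z - (-1) ^+ m * ((p ^ g)%:Z - 1) * (p ^ (g * m.+1))%:Z.
Proof.
move=> kE nE; rewrite coprimeMr => /andP[]; rewrite coprimen2 => r_odd r_m.
have n_gt0 := card_exponent_gt0 cardF.
have g_gt0 : (0 < g)%N by case: g nE n_gt0 {kE} => // ->.
have Q_gt1 : (1 < p ^ g)%N by rewrite -(exp1n g) ltn_exp2r ?prime_gt1.
have gcd1 : gcdn k n = g.
  have /eqP rm2 : coprime r (2 * m) by rewrite coprimeMr coprimen2 r_odd.
  by rewrite kE nE (mulnC 2) -mulnA -muln_gcdr rm2 muln1.
have gcd2 : gcdn (k + k) n = (2 * g)%N.
  by rewrite addnn -mul2n kE nE mulnA -muln_gcdr (eqP r_m) muln1.
have powpp (x : F) j : x ^+ (p ^ j) ^+ (p ^ j) = x ^+ (p ^ (j + j)).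
  by rewrite -exprM -expnD.
rewrite (@card_affine_hermitian_tower F (p ^ k) (p ^ g) Q_gt1 _ _ _ _ m).
- have pX i j : (p ^ i)%:Z ^+ j = (p ^ (i * j))%:Z.
    by rewrite expnM -[in LHS]natz -natrX natz.
  by rewrite !pX nE mulnCA mulnA.
- exact: exprD_pow p_prime cardF _.
- by rewrite (card_frobenius_fixed p_prime cardF) gcd1.
- rewrite -expnM mulnC -gcd2 -(card_frobenius_fixed p_prime cardF).
  by apply: eq_card => x; rewrite !inE powpp.
- move=> b b_fix; have [->|b_neq0] := eqVneq b 0.
    have p0 : (0 : F) ^+ (p ^ k) = 0.
      by rewrite expr0n gtn_eqF ?expn_gt0 ?prime_gt0.
    by exists 0; rewrite ?exprS ?mul0r ?p0.
  have /eqP bQ : b ^+ (p ^ g) == b.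
    by rewrite -gcd1 -(frobenius_fixed_gcd cardF) b_fix.
  (* b is a power z^j of a generator z of the nonzero elements of the larger
     fixed field, and b^(p^g - 1) = 1 forces p^g + 1 to divide j. *)
  have [z z_prim] : exists z : F, (p ^ (2 * g)).-1.-primitive_root z.
    apply: prim_root_dvd_card.
    by rewrite cardF nE (expnM p (2 * g)) dvdn_pred_predX.
  have b1 : b ^+ (p ^ g).-1 = 1.
    by apply: (mulfI b_neq0); rewrite -exprS (ltn_predK Q_gt1) bQ mulr1.
  have Q2E : (p ^ (2 * g)).-1 = ((p ^ g).-1 * (p ^ g).+1)%N.
    by rewrite mul2n -addnn expnD; nia.
  have [j bE] : exists j, b = z ^+ j.
    have [|j ->] := prim_rootP z_prim (x := b); last by exists j.
    by rewrite Q2E exprM b1 expr1n.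
  have /dvdnP[i jE] : ((p ^ g).+1 %| j)%N.
    have : ((p ^ g).-1 * (p ^ g).+1 %| (p ^ g).-1 * j)%N.
      by rewrite -Q2E (prim_order_dvd z_prim) mulnC exprM -bE b1.
    by rewrite dvdn_pmul2l // -subn1 subn_gt0.
  have a_fix : (z ^+ i) ^+ (p ^ (2 * g)) = z ^+ i.
    rewrite -[(p ^ (2 * g))%N]prednK ?expn_gt0 ?prime_gt0 // exprS.
    by rewrite [_ ^+ _.-1]exprAC (prim_expr_order z_prim) expr1n mulr1.
  have aq : (z ^+ i) ^+ (p ^ k) = (z ^+ i) ^+ (p ^ g).
    rewrite kE -(odd_double_half r) r_odd mulnDr muln1 addnC expnD exprM.
    by rewrite -mul2n mulnCA mulnA (frobenius_iter_fixed _ a_fix).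
  exists (z ^+ i).
    by rewrite aq exprAC aq powpp addnn -mul2n.
  by rewrite exprS aq -exprS -exprM -jE bE.
by rewrite cardF nE -expnM; congr (_ ^ _)%N; lia.
Qed.

(** By hypothesis x^(q^2) = x implies x^q = x.  For p odd, a zero c of
    y^q + y has c^q = - c, so c^(q^2) = c, c = - c and c = 0.  For p = 2, if
    u^(q+1) = 1 then u^q = u^-1, so u^(q^2) = u, u = u^-1 and u = 1.  So the
    curve is the graph of x as a function of y, or of y as a function of
    x. *)
Lemma card_affine_hermitian_odd (k : nat) : gcdn (k + k) n = gcdn k n ->
  #|affine_hermitian F (p ^ k)| = (p ^ n)%N.
Proof.
move=> gcd2; rewrite -cardF -cardsT; set q := (p ^ k)%N.
have fix2 (x : F) : x ^+ q ^+ q = x -> x ^+ q = x.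
  move=> x_fix; apply/eqP; rewrite (frobenius_fixed_gcd cardF) -gcd2.
  by rewrite -(frobenius_fixed_gcd cardF) expnD exprM x_fix.
have q_gt0 : (0 < q)%N by rewrite expn_gt0 prime_gt0.
have frobD (x y : F) : (x + y) ^+ q = x ^+ q + y ^+ q.
  exact: exprD_pow p_prime cardF _ _ _.
have p_char : p \in [pchar F] by rewrite (card_finPcharP cardF).
have [p2|p_odd] := eqVneq p 2.
  have norm_inj : injective (fun x : F => x ^+ q.+1).
    move=> x y /= eq_xy; have [y0|y_neq0] := eqVneq y 0.
      by move/eqP: eq_xy; rewrite y0 expr0n expf_eq0 => /eqP.
    pose u := x / y; suff u1 : u = 1 by rewrite -(divfK y_neq0 x) -/u u1 mul1r.
    have uN : u ^+ q.+1 = 1 by rewrite exprMn exprVn eq_xy divff ?expf_neq0.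
    have u_neq0 : u != 0.
      by apply/eqP => u0; move/eqP: uN; rewrite u0 expr0n eq_sym oner_eq0.
    have uq : u ^+ q = u^-1.
      by apply: (mulfI u_neq0); rewrite -exprS uN divff.
    have /eqP : u ^+ 2 = 1 ^+ 2.
      rewrite expr2 -{2}(fix2 u) ?uq ?exprVn ?uq ?invrK // divff ?expr1n //.
    rewrite eqf_sqr oppr_pchar2 ?orbb; first by move/eqP.
    by move: p_char; rewrite p2.
  have [norm' normK normK'] := injF_bij norm_inj.
  have graph_inj : injective (fun y : F => (norm' (y ^+ q + y), y)).
    by move=> y y' [].
  rewrite -(card_imset _ graph_inj); apply: eq_card => -[x y].
  rewrite inE /=; apply/eqP/imsetP=> [xy|[y' _ [-> ->]]].
    by exists y; rewrite // xy normK.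
  by rewrite normK'.
have trace_inj : injective (fun y : F => y ^+ q + y).
  move=> y y' /= eq_yy; apply/eqP; rewrite -subr_eq0; set c := y - y'.
  have c0 : c ^+ q + c = 0.
    have frobN (x : F) : (- x) ^+ q = - x ^+ q.
      by apply: (addIr (x ^+ q)); rewrite -frobD !addNr expr0n gtn_eqF.
    by rewrite frobD frobN addrACA eq_yy -opprD subrr.
  have cq : c ^+ q = - c by apply/eqP; rewrite -addr_eq0 c0.
  have c_fix : c ^+ q = c.
    apply: fix2; apply: (addIr (c ^+ q)).
    by rewrite -frobD [RHS]addrC c0 expr0n gtn_eqF.
  move: c0; rewrite c_fix -mulr2n -mulr_natl => /eqP; rewrite mulf_eq0.
  case/orP=> //; rewrite -(dvdn_pcharf p_char) dvdn_prime2 //.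
  by rewrite (negPf p_odd).
have [trace' traceK traceK'] := injF_bij trace_inj.
have graph_inj : injective (fun x : F => (x, trace' (x ^+ q.+1))).
  by move=> x x' [].
rewrite -(card_imset _ graph_inj); apply: eq_card => -[x y].
rewrite inE /=; apply/eqP/imsetP=> [xy|[x' _ [-> ->]]].
  by exists x; rewrite // -xy traceK.
by rewrite traceK'.
Qed.

End AffineCounts.

(** * The gcd of n with 2k and 4k *)

Lemma gcdn_double_of_ndvd (v w n : nat) : odd w -> (0 < n)%N ->
  ~~ (2 ^ v.+1 %| n)%N ->
  gcdn (2 ^ v * w + 2 ^ v * w) n = gcdn (2 ^ v * w) n.
Proof.
move=> w_odd n_gt0 ndvd_n; set k := (2 ^ v * w)%N.
apply/eqP; rewrite eqn_dvd; apply/andP; split; last first.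
  rewrite dvdn_gcd dvdn_gcdr andbT (dvdn_trans (dvdn_gcdl k n)) //.
  by rewrite addnn -mul2n dvdn_mull.
set h := gcdn (k + k) n; rewrite dvdn_gcd dvdn_gcdr andbT.
have h_gt0 : (0 < h)%N by rewrite gcdn_gt0 n_gt0 orbT.
have [h' cop_h' hE] := pfactor_coprime (isT : prime 2) h_gt0.
have log_le : (logn 2 h <= v)%N.
  rewrite leqNgt -pfactor_dvdn //; apply: contra ndvd_n => /dvdn_trans; apply.
  exact: dvdn_gcdr.
rewrite hE /k mulnC dvdn_mul ?dvdn_exp2l //.
have : (h' %| k + k)%N.
  by rewrite (dvdn_trans _ (dvdn_gcdl _ n)) // -/h hE dvdn_mulr.
rewrite addnn -mul2n mulnA -expnS Gauss_dvdr // coprime_sym.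
by rewrite coprime_pexpl.
Qed.

(** Here u = gcd(w, n / 2^(v+1)), and 2^v * u is the gcd of 2^v * w and n. *)
Lemma gcd_decomposition (v w n : nat) : odd w -> (2 ^ v.+1 %| n)%N ->
  exists u r m : nat,
    [/\ w = (u * r)%N, n = (2 * (2 ^ v * u) * m)%N & coprime r (2 * m)].
Proof.
move=> w_odd /dvdnP[t ->]; have w_gt0 := odd_gt0 w_odd.
set u := gcdn w t; have u_gt0 : (0 < u)%N by rewrite gcdn_gt0 w_gt0.
exists u, (w %/ u)%N, (t %/ u)%N.
have wE : w = (u * (w %/ u))%N by rewrite mulnC divnK ?dvdn_gcdl.
have tE : t = (u * (t %/ u))%N by rewrite mulnC divnK ?dvdn_gcdr.
split=> //; first by rewrite {1}tE expnS; lia.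
rewrite coprimeMr coprimen2; apply/andP; split.
  by move: w_odd; rewrite {1}wE oddM => /andP[].
by rewrite /coprime -(eqn_pmul2l u_gt0) muln_gcdr -wE -tE muln1.
Qed.

Lemma gcd_4k_decomposition (g r m : nat) : coprime r m ->
  gcdn (2 * g * m) (4 * (g * r)) = (if odd m then 2 * g else 4 * g)%N.
Proof.
move=> r_m; have -> : (4 * (g * r) = 2 * g * (2 * r))%N by lia.
rewrite -muln_gcdr Gauss_gcdl 1?coprime_sym //.
case: ifPn => m_odd.
  by have /eqP -> : coprime m 2; rewrite ?muln1 ?coprimen2.
by rewrite (gcdn_idPr _) ?dvdn2 //; lia.
Qed.

Theorem corollary1 (R : realType) (p k v w n d : nat) (F : finFieldType)
    (p_prime : prime p) (k_gt0 : (0 < k)%N)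
    (kE : k = (2 ^ v * w)%N) (w_odd : odd w)
    (n_gt0 : (0 < n)%N) (dE : d = gcdn n (4 * k))
    (cardF : #|F| = (p ^ n)%N) :
  let P : R := p%:R in
  let lhs : R :=
    - (P `^ (- (n%:R / 2%:R)))
      * (#|hermitian_points F p k|%:R - (P ^+ n + 1)) in
  [/\ ~~ (2 ^ v.+1 %| d)%N -> lhs = 0,
      exactly_pow2 v.+1 d ->
        lhs = - (P `^ (d%:R / 2%:R)) * (P `^ (d%:R / 2%:R) - 1)
    & (2 ^ v.+2 %| d)%N ->
        lhs = P `^ (d%:R / 4%:R) * (P `^ (d%:R / 4%:R) - 1)].
Proof.
move=> P lhs.
have P_gt0 : 0 < P by rewrite ltr0n prime_gt0.
have lhsE : lhs = - (P `^ (- (n%:R / 2%:R)))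
    * (#|affine_hermitian F (p ^ k)|%:R - P ^+ n).
  by rewrite /lhs card_hermitian_points ?prime_gt0 // -natr1; ring.
have dvd_d_n : (2 ^ v.+1 %| d)%N = (2 ^ v.+1 %| n)%N.
  have k4E : (4 * k = 2 ^ v.+1 * (2 * w))%N by rewrite kE expnS; lia.
  by rewrite dE dvdn_gcd k4E dvdn_mulr ?andbT.
have [dvd_n|ndvd_n] := boolP (2 ^ v.+1 %| n)%N; last first.
  rewrite /exactly_pow2 dvd_d_n (negPf ndvd_n); split=> // [_|dvd2_d].
    rewrite lhsE (card_affine_hermitian_odd p_prime cardF).
      by rewrite natrX subrr mulr0.
    by rewrite kE gcdn_double_of_ndvd.
  case/negP: ndvd_n; rewrite -dvd_d_n (dvdn_trans _ dvd2_d) //.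
  by rewrite dvdn_exp2l.
have [u [r [m [wE nE r_2m]]]] := gcd_decomposition w_odd dvd_n.
set g := (2 ^ v * u)%N in nE.
have kgr : k = (g * r)%N by rewrite kE wE mulnA.
have /andP[r_odd r_m] : coprime r 2 && coprime r m by rewrite -coprimeMr.
have dgE : d = (if odd m then 2 * g else 4 * g)%N.
  by rewrite dE kgr nE gcd_4k_decomposition.
pose A := P ^+ g.
have lhsA : lhs = (-1) ^+ m * (A * (A - 1)).
  have half_n : n%:R / 2%:R = (g * m)%:R :> R.
    by rewrite nE -mulnA natrM mulrAC divff ?mul1r // pnatr_eq0.
  rewrite lhsE powRN half_n powR_mulrn ?ltW //.
  have := congr1 (fun z : int => z%:~R : R)
    (card_affine_hermitian_even p_prime cardF kgr nE r_2m).
  rewrite rmorphB !rmorphM rmorphB rmorph_sign rmorph1 /= -!pmulrn !natrX -/P.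
  move=> ->; have Agm : P ^+ (g * m) != 0 by rewrite expf_neq0 // gt_eqF.
  by rewrite mulnS exprD -/A; field.
have pow_d c : (0 < c)%N -> d = (c * g)%N -> P `^ (d%:R / c%:R) = A.
  move=> c_gt0 ->; rewrite natrM mulrAC divff ?mul1r ?powR_mulrn ?ltW //.
  by rewrite pnatr_eq0 -lt0n.
have u_odd : odd u by move: w_odd; rewrite wE oddM => /andP[].
rewrite lhsA; split.
- by rewrite dvd_d_n dvd_n.
- case/andP=> _; case: ifPn dgE => [m_odd|_] dgE.
    by rewrite !(pow_d 2%N) // -signr_odd m_odd mulN1r mulNr.
  by rewrite dgE /g !expnS !mulnA dvdn_mulr.
- case: ifPn dgE => [_|m_even] dgE.
    rewrite dgE /g mulnA -expnS [(2 ^ v.+2)%N]expnSr dvdn_pmul2l ?expn_gt0 //.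
    by rewrite dvdn2 u_odd.
  by rewrite !(pow_d 4%N) // -signr_odd (negPf m_even) mul1r.
Qed.
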